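(* For every normal matrix $A\in\mathbb{C}^{n\times n}$, $$G(A)=F(A),$$ where $F(A)$ is the classical field of values and $G(A)$ is the generalized two-sided field of values of $A$.
   Context: $X^{*}$ denotes the conjugate transpose. The classical field of values (numerical range) is $F(A)=\{x^{*}Ax : x\in\mathbb{C}^{n},\ x^{*}x=1\}$. For a nondefective (diagonalizable) matrix $A\in\mathbb{C}^{n\times n}$ with diagonalization $A=V\Lambda V^{-1}$ ($V$ nonsingular with columns right eigenvectors of $A$, $\Lambda$ the diagonal matrix of eigenvalues), the generalized two-sided field of values is $$G(A)=\{y^{*}Ax : x,y\in\mathbb{C}^{n},\ y=(VV^{*})^{-1}x,\ y^{*}x=1\}.$$ The notation does not display $V$; the statement is understood for an arbitrary choice of diagonalization. *)

(* Defs.v *)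
From mathcomp Require Import all_boot all_order all_algebra.
From mathcomp Require Import all_real_closed.
From mathcomp Require Import classical_sets reals.

Set Implicit Arguments.
Unset Strict Implicit.
Unset Printing Implicit Defensive.

Import Order.TTheory GRing.Theory Num.Theory.

Local Open Scope ring_scope.
Local Open Scope sesquilinear_scope.
Local Open Scope classical_set_scope.

(* [M ^t*] is the conjugate transpose of [M]; vectors are columns, so the
   scalar y* A x is the entry (0, 0) of a 1 x 1 matrix. *)

Definition field_of_values (C : numClosedFieldType) (n : nat) (A : 'M[C]_n) :
    set C :=
  [set z | exists x : 'cV[C]_n,
     (x ^t* *m x) 0 0 = 1 /\ z = (x ^t* *m A *m x) 0 0].

(* The row vector [d] lists the eigenvalues of [A]; the columns of [V] are
   then right eigenvectors, [A *m V = V *m diag_mx d]. *)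
Definition is_diagonalization (C : numClosedFieldType) (n : nat)
    (A V : 'M[C]_n) (d : 'rV[C]_n) : Prop :=
  V \in unitmx /\ A = V *m diag_mx d *m invmx V.

(* The usual notation G(A) leaves the eigenvector matrix [V] implicit although
   the set may depend on it.  Only meaningful when [V] diagonalizes [A]. *)
Definition two_sided_field_of_values (C : numClosedFieldType) (n : nat)
    (A V : 'M[C]_n) : set C :=
  [set z | exists x y : 'cV[C]_n,
     [/\ y = invmx (V *m V ^t*) *m x,
         (y ^t* *m x) 0 0 = 1 &
         z = (y ^t* *m A *m x) 0 0]].

(* Main.v *)
Require Import Defs.
From mathcomp Require Import all_boot all_order all_algebra.
From mathcomp Require Import all_real_closed.
From mathcomp Require Import classical_sets reals.
From mathcomp Require Import fingroup perm.

Set Implicit Arguments.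
Unset Strict Implicit.
Unset Printing Implicit Defensive.

Import GRing.Theory.

Local Open Scope ring_scope.
Local Open Scope sesquilinear_scope.

(** Write [M^H] for the conjugate transpose.  Substituting [x = V u] turns
    [y = (V V^H)^-1 x] into [V^-H u], so that [y^H x = u^H u] and
    [y^H A x = u^H D u] with [D = V^-1 A V] diagonal.  Hence, for any
    diagonalizable matrix, the two-sided field of values is the classical field
    of values of the diagonal matrix of eigenvalues
    ([two_sided_field_of_valuesE]).

    A normal matrix also has a diagonalization with a unitary eigenvector
    matrix [W], for which [W W^H = 1] and the two-sided field of values is
    [F(A)] itself ([two_sided_field_of_values_unitary]).  So [G(A)] and [F(A)]
    are the fields of values of two diagonal matrices, both similar to [A].
    Their diagonals agree up to order, as the roots of the characteristic
    polynomial ([diagonalization_perm]), and reordering the diagonal amounts to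
    reordering the coordinates of the vectors ([field_of_values_diag_perm]). *)

Section FieldsOfValues.
Context (C : numClosedFieldType) (n : nat).
Implicit Types (A V : 'M[C]_n) (d e : 'rV[C]_n).

Lemma trmxC_mul m p q (M : 'M[C]_(m, p)) (N : 'M[C]_(p, q)) :
  (M *m N) ^t* = N ^t* *m M ^t*.
Proof. by rewrite trmx_mul map_mxM. Qed.

Lemma trmxC_unitmx V : (V ^t* \in unitmx) = (V \in unitmx).
Proof. by rewrite map_unitmx unitmx_tr. Qed.

(** The change of variable [x = V u] is a bijection of the vectors. *)
Lemma two_sided_field_of_valuesE A V d :
  is_diagonalization A V d ->
  two_sided_field_of_values A V = field_of_values (diag_mx d).
Proof.
move=> [uV ->].
have uV' : V ^t* \in unitmx by rewrite trmxC_unitmx.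
(* The y paired with x = V u is V^-H u, and its conjugate transpose is
   u^H V^-1. *)
have yE (u : 'cV[C]_n) :
    (invmx (V *m V ^t*) *m (V *m u)) ^t* = u ^t* *m invmx V.
  have -> : invmx (V *m V ^t*) *m (V *m u) = invmx (V ^t*) *m u.
    rewrite -[in LHS](mulKVmx uV' u) (mulmxA V).
    by rewrite mulKmx // unitmx_mul uV.
  by rewrite trmxC_mul -map_invmx -trmx_inv trmxCK.
rewrite eqEsubset; split=> z /=.
  move=> [x [y [-> + ->]]]; rewrite -(mulKVmx uV x).
  move: (invmx V *m x) => u; rewrite yE !mulmxA !mulmxKV // => u1.
  by exists u.
move=> [u [u1 ->]].
exists (V *m u), (invmx (V *m V ^t*) *m (V *m u)).
by rewrite yE !mulmxA !mulmxKV.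
Qed.

Lemma two_sided_field_of_values_unitary A V :
  V \is unitarymx -> two_sided_field_of_values A V = field_of_values A.
Proof.
move=> /unitarymxP VV1; rewrite /two_sided_field_of_values VV1 invmx1.
rewrite eqEsubset; split=> z /=.
  by move=> [x [y [-> ]]]; rewrite mul1mx => x1 ->; exists x.
by move=> [x [x1 ->]]; exists x, x; rewrite mul1mx.
Qed.

(** The spectral theorem writes [A] as [P^-1 D P] with [P] unitary, so the
    eigenvector matrix is [P^-1 = P^H]. *)
Lemma normal_unitary_diagonalization A :
  A \is normalmx ->
  exists V d, V \is unitarymx /\ is_diagonalization A V d.
Proof.
move=> /orthomx_spectralP Adiag; have uP := spectral_unitarymx A.
exists (invmx (spectralmx A)), (spectral_diag A); split.
  by rewrite invmx_unitary // trmxC_unitary.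
by split; rewrite ?invmxK // unitmx_inv unitarymx_unit.
Qed.

Lemma char_poly_diagonalization A V d :
  is_diagonalization A V d -> char_poly A = \prod_(i < n) ('X - (d 0 i)%:P).
Proof.
move=> [uV ->].
have VV1 : map_mx polyC V *m map_mx polyC (invmx V) = 1%:M.
  by rewrite -map_mxM mulmxV // map_mx1.
have cV : char_poly_mx (V *m diag_mx d *m invmx V) =
    map_mx polyC V *m char_poly_mx (diag_mx d) *m map_mx polyC (invmx V).
  rewrite /char_poly_mx mulmxBr mulmxBl !map_mxM scalar_mxC.
  by rewrite -(mulmxA 'X%:M) VV1 mulmx1.
rewrite /char_poly cV !det_mulmx mulrAC -det_mulmx VV1 det1.
rewrite mul1r -/(char_poly _) char_poly_trig ?diag_mx_is_trig //.
by apply: eq_bigr => i _; rewrite mxE eqxx mulr1n.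
Qed.

(** Both lists of eigenvalues are the roots, with multiplicity, of the
    characteristic polynomial of [A]. *)
Lemma diagonalization_perm A V W d e :
  is_diagonalization A V d -> is_diagonalization A W e ->
  exists s : 'S_n, forall i, e 0 i = d 0 (s i).
Proof.
move=> /char_poly_diagonalization cd /char_poly_diagonalization ce.
have : perm_eq [tuple e 0 i | i < n] [tuple d 0 i | i < n].
  apply: prod_XsubC_eq.
  by rewrite !big_map -!enumT !big_enum /= -cd -ce.
move=> /tuple_permP[s es]; exists s => i.
by have /val_inj/(congr1 (@tnth _ _ ^~ i)) := es; rewrite !tnth_mktuple.
Qed.

(** [x^H D x] is the sum of the [d_i |x_i|^2], so permuting the coordinates of
    [x] along with the diagonal changes neither this sum nor [x^H x]. *)
Lemma field_of_values_diag_sub d e (s : 'S_n) :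
  (forall i, e 0 i = d 0 (s i)) ->
  (field_of_values (diag_mx d) `<=` field_of_values (diag_mx e))%classic.
Proof.
move=> es z [x [x1 ->]]; exists (row_perm s x); split.
  rewrite -x1 !mxE [RHS](reindex_perm s).
  by apply: eq_bigr => i _; rewrite !mxE.
rewrite !mul_mx_diag !mxE [LHS](reindex_perm s).
by apply: eq_bigr => i _; rewrite !mxE es.
Qed.

Lemma field_of_values_diag_perm d e (s : 'S_n) :
  (forall i, e 0 i = d 0 (s i)) ->
  field_of_values (diag_mx d) = field_of_values (diag_mx e).
Proof.
move=> es; rewrite eqEsubset; split; first exact: field_of_values_diag_sub es.
apply: (@field_of_values_diag_sub _ _ (s^-1)%g) => i.
by rewrite es permKV.
Qed.

End FieldsOfValues.

Theorem mainTheorem2 (R : realType) (n : nat) (A V : 'M[R[i]]_n)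
    (d : 'rV[R[i]]_n) :
  A \is normalmx ->
  is_diagonalization A V d ->
  two_sided_field_of_values A V = field_of_values A.
Proof.
move=> nA dA; have [W [e [uW eA]]] := normal_unitary_diagonalization nA.
have [s es] := diagonalization_perm dA eA.
rewrite (two_sided_field_of_valuesE dA) (field_of_values_diag_perm es).
by rewrite -(two_sided_field_of_valuesE eA) two_sided_field_of_values_unitary.
Qed.
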